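(* Let $$\mathbf x=\frac1{3(1+2^3)}\,(1,1,1,2^3,2^3,2^3),\qquad \mathbf y=\frac1{2(1+2^3+3^3)}\,(1,1,2^3,2^3,3^3,3^3).$$ Then $\mathbf x\le_p\mathbf y$ but $\mathbf x\le_{maj}\mathbf y$ does not hold. In particular, power majorization does not imply majorization.
   Context: Let $\mathbf x=(x_1,\dots,x_n)$ and $\mathbf y=(y_1,\dots,y_n)$ be finite sequences of positive real numbers. $\mathbf x\le_{maj}\mathbf y$ ($\mathbf x$ is majorized by $\mathbf y$) means that $\sum_{j=1}^n f(x_j)\le\sum_{j=1}^n f(y_j)$ for all convex functions $f$. Equivalently, after arranging both sequences in decreasing order, $x_1+\dots+x_j\le y_1+\dots+y_j$ for $1\le j\le n-1$ and $x_1+\dots+x_n=y_1+\dots+y_n$. $\mathbf x\le_p\mathbf y$ ($\mathbf x$ is power majorized by $\mathbf y$) means that $\sum_{i=1}^n x_i^p\le\sum_{i=1}^n y_i^p$ for all real $p\notin[0,1]$ and $\sum_{i=1}^n x_i^p\ge\sum_{i=1}^n y_i^p$ for all $p\in[0,1]$. *)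

(* Defs.v *)
From HB Require Import structures.
From mathcomp Require Import all_boot all_order all_algebra.
From mathcomp Require Import all_classical all_reals all_analysis.

Set Implicit Arguments.
Unset Strict Implicit.
Unset Printing Implicit Defensive.

Import Order.TTheory GRing.Theory Num.Theory.
Import numFieldNormedType.Exports.

Local Open Scope classical_set_scope.
Local Open Scope ring_scope.

Definition positive_seq (R : realType) (n : nat) (x : n.-tuple R) : Prop :=
  forall i : 'I_n, 0 < tnth x i.

(* The sequences being compared are positive, so the test functions are the
   convex functions on the open half-line; values of [f] outside it are
   irrelevant. *)
Definition majorized (R : realType) (n : nat) (x y : n.-tuple R) : Prop :=
  forall f : R -> R,
    convex_function (E := R^o) [set t : R^o | 0 < t] (f : R^o -> R^o) ->
    \sum_(j < n) f (tnth x j) <= \sum_(j < n) f (tnth y j).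

Definition power_majorized (R : realType) (n : nat) (x y : n.-tuple R) : Prop :=
  (forall p : R, ~ (0 <= p <= 1) ->
     \sum_(i < n) (tnth x i) `^ p <= \sum_(i < n) (tnth y i) `^ p) /\
  (forall p : R, 0 <= p <= 1 ->
     \sum_(i < n) (tnth x i) `^ p >= \sum_(i < n) (tnth y i) `^ p).

Definition x_seq (R : realType) : 6.-tuple R :=
  [tuple of [seq 1 / (3 * (1 + 2 ^+ 3)) * t
            | t <- [tuple 1; 1; 1; 2 ^+ 3; 2 ^+ 3; 2 ^+ 3]]].

Definition y_seq (R : realType) : 6.-tuple R :=
  [tuple of [seq 1 / (2 * (1 + 2 ^+ 3 + 3 ^+ 3)) * t
            | t <- [tuple 1; 1; 2 ^+ 3; 2 ^+ 3; 3 ^+ 3; 3 ^+ 3]]].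

(* Main.v *)
Require Import Defs.
From mathcomp Require Import all_boot all_order all_algebra.
From mathcomp Require Import all_classical all_reals all_analysis.
From mathcomp Require Import ring lra.

Import Order.TTheory GRing.Theory Num.Theory.
Import numFieldNormedType.Exports.

Local Open Scope ring_scope.

(** Write [a = ln 2] and [b = ln 3].  The entries of the two sequences are
    products of powers of 2 and 3, so each power sum is a combination of
    exponentials in [p]; pulling out the common factor [9 ^ (- p)], the sum for
    [y] minus the sum for [x] equals [9 ^ (- p) * gap p] with
    [gap p = 2 (8^-p + 1 + (27/8)^p) - 3 (3^-p + (8/3)^p)] (lemma
    [power_sum_diff]).  The normalisation of the sequences and their equal
    lengths give [gap 0 = gap 1 = 0].  Hence power majorization follows at once
    if [gap] is convex: it is then nonpositive between its two zeros and
    nonnegative outside.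

    The factor is chosen so as to make [gap] convex.  In the second derivative
    the negative terms [3^-p] and [(8/3)^p] have exponents lying between those
    of the positive terms [8^-p] and [(27/8)^p], so convexity of the exponential
    bounds each negative term by a chord, that is, by a combination of the
    positive ones.  The chords are taken with origin [p = 2/3], close to the
    minimum of the second derivative; there the values of the four exponentials
    are rational up to the single number [3 ^ (2/3) >= 52/25].  Lemma
    [gap2_ge0] is thereby reduced to the positivity of two cubic forms in [a]
    and [b], which holds on the cone [11 a <= 7 b], [5 b <= 8 a], a restatement
    of [2 ^ 11 <= 3 ^ 7] and [3 ^ 5 <= 2 ^ 8].

    Majorization fails for the hinge [t |-> max 0 (t - 1/9)]: its sum over [x]
    is [5/9], but its sum over [y] is only [19/36]. *)

(** * Chords of convex functions *)

Lemma chord (R : realType) (f : R -> R) (u x v : R) :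
  (forall t : {i01 R},
     f (conv t (u : R^o) (v : R^o)) <= conv t (f u : R^o) (f v : R^o)) ->
  u < v -> u <= x <= v ->
  (v - u) * f x <= (v - x) * f u + (x - u) * f v.
Proof.
move=> cvx uv /andP[ux xv].
have d0 : 0 < v - u by rewrite subr_gt0.
have t0 : 0 <= (v - x) / (v - u) by rewrite divr_ge0 ?subr_ge0// ltW.
have t1 : (v - x) / (v - u) <= 1 by rewrite ler_pdivrMr// mul1r lerB.
move: (cvx (Itv01 t0 t1)); rewrite !convRE /= /unstable.onem.
set t := _ / _.
have -> : t * u + (1 - t) * v = x by rewrite /t; field; lra.
move=> h.
have -> : v - x = (v - u) * t by rewrite /t; field; lra.
have -> : x - u = (v - u) * (1 - t) by rewrite /t; field; lra.
by rewrite -!(mulrA (v - u)) -mulrDr ler_pM2l.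
Qed.

Lemma expR_chord (R : realType) (s u x v : R) : u < v -> u <= x <= v ->
  (v - u) * expR (x * s) <= (v - x) * expR (u * s) + (x - u) * expR (v * s).
Proof.
apply: (@chord R (fun z => expR (z * s))) => t.
have := convex_expR t (u * s : R^o) (v * s : R^o).
by rewrite !convRE; apply: le_trans; rewrite mulrDl !mulrA.
Qed.

Lemma le_hinge_avg (R : realType) (r u v c : R) : 0 <= r <= 1 ->
  Num.max 0 (r * u + (1 - r) * v - c)
  <= r * Num.max 0 (u - c) + (1 - r) * Num.max 0 (v - c).
Proof.
move=> /andP[r0]; rewrite -subr_ge0 => r1.
rewrite (_ : _ - c = r * (u - c) + (1 - r) * (v - c)); last by ring.
rewrite ge_max; apply/andP; split.
  by rewrite addr_ge0// mulr_ge0// le_max lexx.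
by rewrite lerD// ler_wpM2l// le_max lexx orbT.
Qed.

Lemma hinge_convex (R : realType) (D : set R^o) (c : R) :
  convex_function (E := R^o) D (fun t : R^o => Num.max 0 (t - c) : R^o).
Proof. by move=> t x y _ _; apply: le_hinge_avg; apply/andP; split. Qed.

(** * Numerical facts about logarithms *)

Section PowerSums.
Variable R : realType.

Local Notation a := (ln 2 : R).
Local Notation b := (ln 3 : R).

Lemma expR_ln2 : expR a = 2.
Proof. by rewrite lnK// posrE. Qed.

Lemma expR_ln3 : expR b = 3.
Proof. by rewrite lnK// posrE. Qed.

Lemma ln_nat_le (k l m n : nat) : (0 < k)%N -> (0 < l)%N ->
  (k ^ m <= l ^ n)%N -> m%:R * ln (k%:R : R) <= n%:R * ln (l%:R).
Proof.
move=> k0 l0 kl.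
rewrite -ler_expR !expRM_natl !lnK ?posrE ?ltr0n//.
by rewrite -!natrX ler_nat.
Qed.

Lemma ln2_gt0 : 0 < a.
Proof. by rewrite ln_gt0// ltr1n. Qed.

Lemma ln2_le_ln3 : 11 * a <= 7 * b.
Proof. by apply: ln_nat_le. Qed.

Lemma ln3_le_ln2 : 5 * b <= 8 * a.
Proof. by apply: ln_nat_le. Qed.

Lemma cbrt9_ge : 52 / 25 <= expR (2 / 3 * b).
Proof.
have : expR (2 / 3 * b) ^+ 3 = 9.
  rewrite -expRM_natl (_ : _ * _ = 2 * b); last by field.
  by rewrite expRM_natl expR_ln3; ring.
have := expR_gt0 (2 / 3 * b); move: (expR _) => c c0 c3.
by rewrite leNgt; apply/negP => c_lt; nra.
Qed.

(** Membership in the cone means [u = 5 g + 7 h] and [v = 8 g + 11 h] with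
    [g, h >= 0]; at [c = 52/25] both forms of [cubic_forms_ge0] have nonnegative
    coefficients in [g] and [h]. *)
Lemma cone_param (u v : R) : 11 * u <= 7 * v -> 5 * v <= 8 * u ->
  exists g h : R, [/\ 0 <= g, 0 <= h, u = 5 * g + 7 * h & v = 8 * g + 11 * h].
Proof.
move=> uv vu; exists (7 * v - 11 * u), (8 * u - 5 * v).
by split; lra.
Qed.

Lemma cubic_forms_ge0 (c u v : R) :
  52 / 25 <= c -> 11 * u <= 7 * v -> 5 * v <= 8 * u ->
  0 <= 9 / 2 * u ^+ 2 * v * c
       - v ^+ 2 * (4 * v - 3 * u) - 4 * (3 * u - v) ^+ 2 * (4 * v - 6 * u)
  /\ 0 <= 81 / 2 * (v - u) ^+ 2 * v * c
       - v ^+ 2 * (3 * u - v) - 4 * (3 * u - v) ^+ 2 * (6 * u - v).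
Proof.
move=> hc uv vu; have [g [h [g0 h0 -> ->]]] := cone_param _ _ uv vu.
have g3 : 0 <= g ^+ 3 by rewrite exprn_ge0.
have h3 : 0 <= h ^+ 3 by rewrite exprn_ge0.
have g2h : 0 <= g ^+ 2 * h by rewrite mulr_ge0// exprn_ge0.
have gh2 : 0 <= g * h ^+ 2 by rewrite mulr_ge0// exprn_ge0.
have v0 : 0 <= 8 * g + 11 * h by lra.
have c0 : 0 <= c - 52 / 25 by lra.
split.
- have : 0 <= (5 * g + 7 * h) ^+ 2 * (8 * g + 11 * h) * (c - 52 / 25).
    by rewrite !mulr_ge0//; lra.
  by lra.
- have : 0 <= (8 * g + 11 * h - (5 * g + 7 * h)) ^+ 2 * (8 * g + 11 * h)
              * (c - 52 / 25).
    by rewrite !mulr_ge0//; lra.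
  by lra.
Qed.

(** * The difference of the power sums *)

Definition gap (p : R) : R :=
  2 * (expR (- 3 * a * p) + 1 + expR ((3 * b - 3 * a) * p))
  - 3 * (expR (- b * p) + expR ((3 * a - b) * p)).

Definition gap1 (p : R) : R :=
  2 * (- 3 * a * expR (- 3 * a * p)
       + (3 * b - 3 * a) * expR ((3 * b - 3 * a) * p))
  - 3 * (- b * expR (- b * p) + (3 * a - b) * expR ((3 * a - b) * p)).

Definition gap2 (p : R) : R :=
  2 * ((3 * a) ^+ 2 * expR (- 3 * a * p)
       + (3 * b - 3 * a) ^+ 2 * expR ((3 * b - 3 * a) * p))
  - 3 * (b ^+ 2 * expR (- b * p)
         + (3 * a - b) ^+ 2 * expR ((3 * a - b) * p)).

Lemma gap_at0 : gap 0 = 0.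
Proof. by rewrite /gap !mulr0 expR0; ring. Qed.

Lemma gap_at1 : gap 1 = 0.
Proof.
rewrite /gap !mulr1 -!mulrBr.
by rewrite !(mulNr, expRN, expRB, expRM_natl, expR_ln2, expR_ln3); field.
Qed.

Lemma is_derive_gap (p : R) : is_derive p 1 gap (gap1 p).
Proof.
by rewrite /gap /gap1; apply: is_derive_eq; rewrite /GRing.scale /=; ring.
Qed.

Lemma is_derive_gap1 (p : R) : is_derive p 1 gap1 (gap2 p).
Proof.
by rewrite /gap1 /gap2; apply: is_derive_eq; rewrite /GRing.scale /=; ring.
Qed.

(** With [s = p - 2/3], the chords over the exponents [- 3 a] and [3 b - 3 a] of
    the positive terms bound [expR (- b * s)] and [expR ((3 a - b) * s)].  After
    multiplication by [b * 3 ^ (2/3)], the coefficients left in front of the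
    positive exponentials are the forms of [cubic_forms_ge0]. *)
Lemma gap2_ge0 p : 0 <= gap2 p.
Proof.
pose s := p - 2 / 3; pose c := expR (2 / 3 * b).
have uv := ln2_le_ln3; have vu := ln3_le_ln2; have a0 := ln2_gt0.
have [F G] := cubic_forms_ge0 c _ _ cbrt9_ge uv vu.
have c0 : 0 < c by exact: expR_gt0.
have b0 : 0 < b by lra.
have lt_exps : - 3 * a < 3 * b - 3 * a by lra.
have X_le := expR_chord _ s _ (- b) _ lt_exps ltac:(apply/andP; split; lra).
have Y_le :=
  expR_chord _ s _ (3 * a - b) _ lt_exps ltac:(apply/andP; split; lra).
have P_shift : expR (- 3 * a * p) = expR (- 3 * a * s) / 4.
  rewrite (_ : _ * p = - 3 * a * s - 2 * a); last by rewrite /s; field.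
  by rewrite expRB expRM_natl expR_ln2 -natrX.
have Q_shift :
    expR ((3 * b - 3 * a) * p) = expR ((3 * b - 3 * a) * s) * (9 / 4).
  rewrite (_ : _ * p = (3 * b - 3 * a) * s + (2 * b - 2 * a)).
    by rewrite expRD expRB !expRM_natl expR_ln2 expR_ln3 -!natrX.
  by rewrite /s; field.
have X_shift : expR (- b * p) = expR (- b * s) / c.
  by rewrite (_ : _ * p = (- b) * s - 2 / 3 * b) ?expRB// /s; field.
have Y_shift : expR ((3 * a - b) * p) = expR ((3 * a - b) * s) * (4 / c).
  rewrite (_ : _ * p = (3 * a - b) * s + (2 * a - 2 / 3 * b)).
    by rewrite expRD expRB expRM_natl expR_ln2 -natrX.
  by rewrite /s; field.
rewrite /gap2 P_shift Q_shift X_shift Y_shift.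
move: (expR_gt0 (- 3 * a * s)) (expR_gt0 ((3 * b - 3 * a) * s)) X_le Y_le.
move: (expR (- 3 * a * s)) (expR ((3 * b - 3 * a) * s)) (expR (- b * s))
  (expR ((3 * a - b) * s)) => P Q X Y P0 Q0 X_le Y_le
  {P_shift Q_shift X_shift Y_shift}.
rewrite -(pmulr_lge0 _ (mulr_gt0 b0 c0)).
have FP := mulr_ge0 (ltW P0) F; have GQ := mulr_ge0 (ltW Q0) G.
have bX := ler_wpM2l (sqr_ge0 b) X_le.
have bY := ler_wpM2l (sqr_ge0 (3 * a - b)) Y_le.
rewrite (_ : _ * (b * c) =
    9 / 2 * a ^+ 2 * b * c * P + 81 / 2 * (b - a) ^+ 2 * b * c * Q
    - b ^+ 2 * (3 * b * X) - 4 * (3 * a - b) ^+ 2 * (3 * b * Y)).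
  by lra.
by field; lra.
Qed.

Lemma gap_chord u x v : u < v -> u <= x <= v ->
  (v - u) * gap x <= (v - x) * gap u + (x - u) * gap v.
Proof.
move=> uv; apply: chord => // t.
have Dgap : 'D_1 gap = gap1.
  by apply: funext => p; have ? := is_derive_gap p; rewrite derive_val.
have gap_cont z : continuous_at z gap.
  apply: differentiable_continuous; apply/derivable1_diffP.
  by case: (is_derive_gap z).
apply: second_derivative_convex; last exact: ltW.
- move=> z _; rewrite Dgap; have ? := is_derive_gap1 z.
  by rewrite derive_val gap2_ge0.
- by apply: cvg_at_left_filter; exact: gap_cont.
- by apply: cvg_at_right_filter; exact: gap_cont.
- by move=> z _; case: (is_derive_gap z).
- by move=> z _; rewrite Dgap; case: (is_derive_gap1 z).
Qed.

Lemma gap_le0 p : 0 <= p <= 1 -> gap p <= 0.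
Proof. by move=> /(gap_chord _ _ _ ltr01); rewrite gap_at0 gap_at1; lra. Qed.

Lemma gap_ge0 p : ~ (0 <= p <= 1) -> 0 <= gap p.
Proof.
move=> /negP; rewrite negb_and -!ltNge => /orP[p0|p1].
  (* [0] lies on the chord from [p] to [1] *)
  have p1 : p < 1 by lra.
  have := gap_chord p 0 1 p1 ltac:(apply/andP; split; lra).
  by rewrite gap_at0 gap_at1; nra.
(* [1] lies on the chord from [0] to [p] *)
have p0 : 0 < p by lra.
have := gap_chord 0 1 p p0 ltac:(apply/andP; split; lra).
by rewrite gap_at0 gap_at1; nra.
Qed.

Lemma sum_x_seq (f : R -> R) :
  \sum_(i < 6) f (tnth (x_seq R) i) = 3 * (f (1 / 27) + f (8 / 27)).
Proof.
rewrite !big_ord_recl big_ord0 /= /x_seq !(tnth_nth 0) /=.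
rewrite (_ : 1 / _ * 1 = 1 / 27); last by field.
rewrite (_ : 1 / _ * _ = 8 / 27); last by field.
by ring.
Qed.

Lemma sum_y_seq (f : R -> R) :
  \sum_(i < 6) f (tnth (y_seq R) i)
  = 2 * (f (1 / 72) + f (1 / 9) + f (3 / 8)).
Proof.
rewrite !big_ord_recl big_ord0 /= /y_seq !(tnth_nth 0) /=.
rewrite (_ : 1 / _ * 1 = 1 / 72); last by field.
rewrite (_ : 1 / _ * 2 ^+ 3 = 1 / 9); last by field.
rewrite (_ : 1 / _ * _ = 3 / 8); last by field.
by ring.
Qed.

Lemma power_sum_diff p :
  \sum_(i < 6) (tnth (y_seq R) i) `^ p - \sum_(i < 6) (tnth (x_seq R) i) `^ p
  = expR (- (2 * b) * p) * gap p.
Proof.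
rewrite (sum_x_seq (fun t => t `^ p)) (sum_y_seq (fun t => t `^ p)).
have -> : 1 / 27 = expR (- (2 * b) - b).
  by rewrite expRB expRN expRM_natl expR_ln3; field.
have -> : 8 / 27 = expR (- (2 * b) + (3 * a - b)).
  by rewrite expRD expRN expRB !expRM_natl expR_ln2 expR_ln3; field.
have -> : 1 / 72 = expR (- (2 * b) + - 3 * a).
  by rewrite expRD mulNr !expRN !expRM_natl expR_ln2 expR_ln3; field.
have -> : 1 / 9 = expR (- (2 * b)).
  by rewrite expRN expRM_natl expR_ln3; field.
have -> : 3 / 8 = expR (- (2 * b) + (3 * b - 3 * a)).
  by rewrite expRD expRN expRB !expRM_natl expR_ln2 expR_ln3; field.
by rewrite -!expRM /gap !mulrDl !expRD; ring.
Qed.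

Lemma x_seq_power_majorized : power_majorized (x_seq R) (y_seq R).
Proof.
split=> p hp; rewrite -subr_ge0.
  by rewrite power_sum_diff mulr_ge0 ?expR_ge0 ?gap_ge0.
by rewrite -opprB power_sum_diff oppr_ge0 mulr_ge0_le0 ?expR_ge0 ?gap_le0.
Qed.

(** * Failure of majorization *)

Lemma x_seq_not_majorized : ~ majorized (x_seq R) (y_seq R).
Proof.
move=> /(_ (fun t => Num.max 0 (t - 1 / 9)) (hinge_convex _ _ _)).
rewrite (sum_x_seq (fun t => Num.max 0 (t - 1 / 9))).
rewrite (sum_y_seq (fun t => Num.max 0 (t - 1 / 9))).
rewrite (max_l (_ : 1 / 27 - 1 / 9 <= 0)); last by lra.
rewrite (max_r (_ : 0 <= 8 / 27 - 1 / 9)); last by lra.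
rewrite (max_l (_ : 1 / 72 - 1 / 9 <= 0)); last by lra.
rewrite (max_l (_ : 1 / 9 - 1 / 9 <= 0)); last by lra.
rewrite (max_r (_ : 0 <= 3 / 8 - 1 / 9)); last by lra.
by lra.
Qed.

Lemma x_seq_positive : positive_seq (x_seq R).
Proof.
move=> i; apply: (allP _ _ (mem_tnth i _)) => /=.
by rewrite !mulr_gt0 ?divr_gt0 ?addr_gt0 ?mulr_gt0 ?exprn_gt0 ?addr_gt0 ?exprn_gt0.
Qed.

Lemma y_seq_positive : positive_seq (y_seq R).
Proof.
move=> i; apply: (allP _ _ (mem_tnth i _)) => /=.
by rewrite !mulr_gt0 ?divr_gt0 ?addr_gt0 ?mulr_gt0 ?exprn_gt0 ?addr_gt0 ?exprn_gt0.
Qed.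

End PowerSums.

Theorem mainTheorem3 (R : realType) :
  [/\ power_majorized (x_seq R) (y_seq R),
      ~ majorized (x_seq R) (y_seq R)
    & ~ (forall (n : nat) (x y : n.-tuple R),
           positive_seq x -> positive_seq y ->
           power_majorized x y -> majorized x y)].
Proof.
split; [exact: x_seq_power_majorized | exact: x_seq_not_majorized |].
move=> pow_maj; apply: (@x_seq_not_majorized R); apply: pow_maj.
- exact: x_seq_positive.
- exact: y_seq_positive.
- exact: x_seq_power_majorized.
Qed.
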